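(* Consider a system $\dot x(t) = Ax(t) + BL(t)u(t) + f(t,x(t),u(t))$, $x(0)=x^0$, $y(t)=Cx(t)$, satisfying (P1) and (P2), such that $U$ is a Lyapunov transformation. Then \[ (\hat A, \hat B, \hat C) := \big( (UA+\dot U)U^{-1},\ UBL,\ CU^{-1}\big) \] and $\hat f(t,z,u) := U(t) f\big(t,U(t)^{-1}z,u\big)$, $(t,z,u)\in\mathbb{R}^{1+n+m}$, satisfy \[ \hat A(t) = \begin{bmatrix} 0 & I_p & 0 & \cdots & 0 & 0\\ 0 & 0& I_p & & & 0\\ \vdots & \vdots & \ddots & \ddots & & \vdots\\ 0 & 0 & \cdots & 0 & I_p & 0\\ R_1(t) & R_2(t) & \cdots & R_{r-1}(t) & R_r(t) & S(t)\\ P_1(t) & P_2(t) & \cdots & P_{r-1}(t) & P_r(t) & Q(t)\end{bmatrix},\quad \hat B(t) = \begin{bmatrix} 0\\ \vdots\\ 0\\ \Gamma L(t)\\ N(t)\end{bmatrix}, \] \[ \hat C = \begin{bmatrix} I_p & 0 & \cdots & 0\end{bmatrix},\quad \hat f(t,z,u) = \big( 0, \ldots, 0, f_r(t,z,u), f_\eta(t,z,u)\big)^\top, \] where $R_i\in\mathcal{C}^\infty(\mathbb{R}\to\mathbb{R}^{p\times p})$, $P_i, S^\top\in\mathcal{C}^\infty(\mathbb{R}\to\mathbb{R}^{(n-pr)\times p})$, $Q\in\mathcal{C}^\infty(\mathbb{R}\to\mathbb{R}^{(n-pr)\times (n-pr)})$, $N\in\mathcal{C}^\infty(\mathbb{R}\to\mathbb{R}^{(n-pr)\times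 m})$, $f_r\in\mathcal{C}(\mathbb{R}\times\mathbb{R}^n\times\mathbb{R}^m\to\mathbb{R}^p)$, $f_\eta\in\mathcal{C}(\mathbb{R}\times\mathbb{R}^n\times\mathbb{R}^m\to\mathbb{R}^{n-pr})$ are all bounded. Furthermore: (i) There exists $K\in\mathcal{C}^\infty(\mathbb{R}\to\mathbb{R}^{m\times p})$ such that $\Gamma L(t) K(t) = I_p$ and $N(t) K(t) = 0$ for all $t\in\mathbb{R}$ if, and only if, \[ \forall\, t\in\mathbb{R}:\ \operatorname{im} \mathcal{B}(t) \big(\mathcal{C}\mathcal{B}(t)\big)^\dagger \begin{bmatrix} 0 \\ I_p\end{bmatrix} \subseteq \operatorname{im} BL(t); \] in this case one may choose $K(t) := \big(BL(t)\big)^\dagger \mathcal{B}(t) \big(\mathcal{C}\mathcal{B}(t)\big)^\dagger \begin{bmatrix} 0 \\ I_p\end{bmatrix}$. (ii) If $q=p$ for $q$ in (P1), then $P_2 = P_3 = \ldots = P_r = 0$ and $N=0$.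
   Context: System: $\dot x(t) = Ax(t) + BL(t)u(t) + f(t,x(t),u(t))$, $x(0)=x^0$, $y(t)=Cx(t)$ with $A\in\mathbb{R}^{n\times n}$, $B\in\mathbb{R}^{n\times m}$, $C\in\mathbb{R}^{p\times n}$, $m\ge p$, $f\in\mathcal{C}(\mathbb{R}\times\mathbb{R}^n\times\mathbb{R}^m\to\mathbb{R}^n)$ bounded. (P1): $L\in\mathcal{C}^\infty(\mathbb{R}\to\mathbb{R}^{m\times m})$ with $L,\dot L,\ldots,L^{(n)}$ bounded and there is $q\in\mathbb{N}$ with $\operatorname{rk} BL(t)=q\ge p$ for all $t$. (P2): relative degree $r\in\mathbb{N}$: $CA^kBL(\cdot)=0$ and $CA^kf(\cdot)=0$ for $k=0,\ldots,r-2$, and $\Gamma:=CA^{r-1}B\in\mathbb{R}^{p\times m}$ satisfies $\operatorname{rk}\Gamma L(t)=p$ for all $t$. Define $\mathcal{B}(t) := \big[BL(t),(\tfrac{d}{dt}-A)(BL(t)),\ldots,(\tfrac{d}{dt}-A)^{r-1}(BL(t))\big]\in\mathbb{R}^{n\times rm}$, $\mathcal{C} := [C^\top,(CA)^\top,\ldots,(CA^{r-1})^\top]^\top\in\mathbb{R}^{rp\times n}$, $\rho:=\operatorname{rk}\mathcal{C}$ (which equals $pr$ under (P1),(P2)), $V\in\mathbb{R}^{n\times(n-\rho)}$ with $\operatorname{im}V=\ker\mathcal{C}$, $\mathcal{N}(t):=V^\dagger[I_n-\mathcal{B}(t)(\mathcal{C}\mathcal{B}(t))^\dagger\mathcal{C}]$,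 and $U(t):=\begin{bmatrix}\mathcal{C}\\ \mathcal{N}(t)\end{bmatrix}$, which is invertible with $U(t)^{-1}=[\mathcal{B}(t)(\mathcal{C}\mathcal{B}(t))^\dagger, V]$. A Lyapunov transformation is $M\in\mathcal{C}^1(\mathbb{R}\to\mathbf{Gl}_n(\mathbb{R}))$ with $M$, $M^{-1}$, $\dot M$ bounded. $M^\dagger$ denotes the Moore–Penrose pseudoinverse. *)

(* Defs.v *)
From HB Require Import structures.
From mathcomp Require Import all_boot all_order all_algebra.
From mathcomp Require Import all_classical all_reals all_analysis.
Set Implicit Arguments. Unset Strict Implicit. Unset Printing Implicit Defensive.
Import Order.TTheory GRing.Theory Num.Theory.
Import numFieldNormedType.Exports.
Local Open Scope ring_scope.
Local Open Scope classical_set_scope.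

Section Defs.
Variable R : realType.

Definition mxn a b (M : 'M[R]_(a, b)) (i j : nat) : R :=
  match @insub nat (fun k => k < a)%N _ i, @insub nat (fun k => k < b)%N _ j with
  | Some i', Some j' => M i' j'
  | _, _ => 0
  end.

Definition smooth (g : R -> R) : Prop :=
  forall (k : nat) (x : R), derivable (derive1n k g) x 1.

Definition C1fun (g : R -> R) : Prop :=
  (forall x : R, derivable g x 1) /\ continuous (fun y : R => derive1 g y).

Definition smooth_mx a b (A : R -> 'M[R]_(a, b)) : Prop :=
  forall i j, smooth (fun t => A t i j).
Definition C1_mx a b (A : R -> 'M[R]_(a, b)) : Prop :=
  forall i j, C1fun (fun t => A t i j).
Definition bounded_mx a b (A : R -> 'M[R]_(a, b)) : Prop :=
  exists M : R, forall t i j, `|A t i j| <= M.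
Definition mxD a b (A : R -> 'M[R]_(a, b)) : R -> 'M[R]_(a, b) :=
  fun t => \matrix_(i, j) derive1 (fun s => A s i j) t.

Definition penrose a b (A : 'M[R]_(a, b)) (X : 'M[R]_(b, a)) : Prop :=
  [/\ A *m X *m A = A, X *m A *m X = X,
      (A *m X)^T = A *m X & (X *m A)^T = X *m A].
Definition mpinv a b (A : 'M[R]_(a, b)) : 'M[R]_(b, a) :=
  xget 0 [set X | penrose A X].

Definition lyapunov n (M : R -> 'M[R]_n) : Prop :=
  [/\ forall t, M t \in unitmx, C1_mx M, bounded_mx M,
      bounded_mx (fun t => invmx (M t)) & bounded_mx (mxD M)].

Fixpoint BLk n m (A : 'M[R]_n) (B : 'M[R]_(n, m)) (L : R -> 'M[R]_m) (k : nat)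
  : R -> 'M[R]_(n, m) :=
  match k with
  | O => fun t => B *m L t
  | S k' => fun t => mxD (BLk A B L k') t - A *m BLk A B L k' t
  end.

(* calB(t) = [BL, (d/dt - A)(BL), ..., (d/dt - A)^(r-1)(BL)] *)
Definition calB n m (r : nat) (A : 'M[R]_n) (B : 'M[R]_(n, m)) (L : R -> 'M[R]_m)
  (t : R) : 'M[R]_(n, r * m) :=
  \matrix_(i < n, j < r * m) mxn (BLk A B L (j %/ m)%N t) i (j %% m)%N.

(* calC = [C; CA; ...; CA^(r-1)] *)
Definition calC n p (r : nat) (A : 'M[R]_n) (C : 'M[R]_(p, n)) : 'M[R]_(r * p, n) :=
  \matrix_(i < r * p, j < n) mxn (C *m A ^+ (i %/ p)%N) (i %% p)%N j.

Arguments calB {n m} r A B L t.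
Arguments calC {n p} r A C.

Definition calN n m p (r : nat) (A : 'M[R]_n) (B : 'M[R]_(n, m)) (C : 'M[R]_(p, n))
  (L : R -> 'M[R]_m) (V : 'M[R]_(n, n - p * r)) (t : R) : 'M[R]_(n - p * r, n) :=
  mpinv V *m (1%:M - calB r A B L t *m mpinv (calC r A C *m calB r A B L t) *m calC r A C).

Arguments calN {n m p} r A B C L V t.

(* U(t) = [calC; calN(t)] (stacked; total dimension p*r + (n - p*r) = n) *)
Definition Umx n m p (r : nat) (A : 'M[R]_n) (B : 'M[R]_(n, m)) (C : 'M[R]_(p, n))
  (L : R -> 'M[R]_m) (V : 'M[R]_(n, n - p * r)) (t : R) : 'M[R]_n :=
  \matrix_(i < n, j < n)
    (if (i < r * p)%N then mxn (calC r A C) i j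
     else mxn (calN r A B C L V t) (i - r * p)%N j).

(* [0; I_p] in R^{rp x p} *)
Definition E_last p (r : nat) : 'M[R]_(r * p, p) :=
  \matrix_(i < r * p, j < p) (i == (r.-1 * p + j)%N :> nat)%:R.

(* the block companion-like form of hat A: rows 0..p(r-1)-1 are shift rows,
   block row r is [R_1 ... R_r S], last block row is [P_1 ... P_r Q] *)
Definition Aform n p (r : nat)
  (Rb : 'I_r -> 'M[R]_(p, p)) (S : 'M[R]_(p, n - p * r))
  (Pb : 'I_r -> 'M[R]_(n - p * r, p)) (Q : 'M[R]_(n - p * r))
  (i j : nat) : R :=
  if (i < p * r.-1)%N then (j == i + p)%N%:R
  else if (i < p * r)%N then
    (if (j < p * r)%N then
       match @insub nat (fun k => k < r)%N _ (j %/ p)%N with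
       | Some k => mxn (Rb k) (i - p * r.-1)%N (j %% p)%N
       | None => 0 end
     else mxn S (i - p * r.-1)%N (j - p * r)%N)
  else
    (if (j < p * r)%N then
       match @insub nat (fun k => k < r)%N _ (j %/ p)%N with
       | Some k => mxn (Pb k) (i - p * r)%N (j %% p)%N
       | None => 0 end
     else mxn Q (i - p * r)%N (j - p * r)%N).

End Defs.
Arguments calB {R n m} r A B L t.
Arguments calC {R n p} r A C.
Arguments calN {R n m p} r A B C L V t.
Arguments Umx {R n m p} r A B C L V t.
Arguments E_last R p r.
Arguments Aform {R n p r} Rb S Pb Q i j.
Arguments BLk {R n m} A B L k.
Arguments mxn {R a b} M i j.

(* Main.v *)
Require Import Defs.
From HB Require Import structures.
From mathcomp Require Import all_boot all_order all_algebra.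
From mathcomp Require Import all_classical all_reals all_analysis.
From mathcomp Require Import ring zify.
Import Order.TTheory GRing.Theory Num.Theory.
Import numFieldNormedType.Exports.
Local Open Scope ring_scope.
Local Open Scope classical_set_scope.

(* The relative degree makes calC calB(t) block triangular along its antidiagonal,
   with blocks +-Gamma L(t) there, so that Z := calB (calC calB)^+ is a right inverse
   of calC. Hence U Z = [I; 0] and calC = [I 0] U, which gives the block forms. Since
   U B L K = [0; Gamma L K; N K], the equations Gamma L K = I, N K = 0 say exactly
   that B L K = Z [0; I], and this is (i). If q = p, then B L = F Gamma L with a smooth
   F; the blocks (d/dt - A)^j F have the same span as calB, calN annihilates them,
   and differentiating calN (d/dt - A)^j F = 0 yields (ii). Smoothness of the
   pseudoinverse of a matrix function of constant rank comes from writing it locally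
   as a quotient of smooth functions. *)

(** * Smooth functions of a real variable *)

Section Smooth.
Context {R : realType}.
Implicit Types f g : R -> R.

(** The first derivative is split off, so that inductions on the order apply the sum and product
    rules before the induction hypothesis; the iterate in [smooth] grows on the outside. *)
Fixpoint nderivable (k : nat) (g : R -> R) : Prop :=
  if k is k'.+1 then (forall x, derivable g x 1) /\ nderivable k' (derive1 g)
  else True.

Lemma smoothP {g} : smooth g <-> forall k, nderivable k g.
Proof.
have shift h k : derive1n k.+1 h = derive1n k (derive1 h) by rewrite /derive1n iterSr.
split=> [+ k|gk].
  elim: k g => [//|k IHk] g gs /=; split; first exact: (gs 0%N).
  by apply: IHk => j x; rewrite -shift; exact: gs.
move=> k; have := gk k.+1; elim: k g {gk} => [|k IHk] g [dg gk]; first exact: dg.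
by rewrite shift; exact: IHk.
Qed.

Lemma nderivableS {k g} : nderivable k.+1 g -> nderivable k g.
Proof. by elim: k g => [//|k IHk] g [dg gk]; split=> //; exact: IHk. Qed.

Lemma nderivable_cst k (c : R) : nderivable k (fun=> c).
Proof.
elim: k c => [//|k IHk] c; split=> [x|]; first exact: derivable_cst.
suff -> : derive1 (fun=> c) = (fun=> 0) :> (R -> R) by [].
by apply/funext => x; rewrite derive1_cst.
Qed.

Lemma derive1D {f g} : (forall x, derivable f x 1) -> (forall x, derivable g x 1) ->
  derive1 (fun x => f x + g x) = (fun x => derive1 f x + derive1 g x).
Proof. by move=> df dg; apply/funext => x; rewrite !derive1E deriveD. Qed.

Lemma derive1M {f g} : (forall x, derivable f x 1) -> (forall x, derivable g x 1) ->
  derive1 (fun x => f x * g x) = (fun x => derive1 f x * g x + f x * derive1 g x).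
Proof.
move=> df dg; apply/funext => x; rewrite !derive1E deriveM //.
by rewrite addrC /GRing.scale /= mulrC.
Qed.

Lemma nderivableD {k f g} : nderivable k f -> nderivable k g ->
  nderivable k (fun x => f x + g x).
Proof.
elim: k f g => [//|k IHk] f g [df fk] [dg gk]; split.
  by move=> x; exact: derivableD.
by rewrite derive1D //; exact: IHk.
Qed.

Lemma nderivableM {k f g} : nderivable k f -> nderivable k g ->
  nderivable k (fun x => f x * g x).
Proof.
elim: k f g => [//|k IHk] f g fk gk.
have [df f'k] := fk; have [dg g'k] := gk; split.
  by move=> x; exact: derivableM.
by rewrite derive1M //; apply: nderivableD; apply: IHk => //; exact: nderivableS.
Qed.

Lemma smooth_derivable {g} x : smooth g -> derivable g x 1.
Proof. exact: (fun gs => gs 0%N x). Qed.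

Lemma smooth_cst (c : R) : smooth (fun=> c).
Proof. by apply/smoothP => k; exact: nderivable_cst. Qed.

Lemma smooth_derive1 {g} : smooth g -> smooth (derive1 g).
Proof. by move=> /smoothP gs; apply/smoothP => k; have [] := gs k.+1. Qed.

Lemma smoothD {f g} : smooth f -> smooth g -> smooth (fun x => f x + g x).
Proof.
by move=> /smoothP fs /smoothP gs; apply/smoothP => k; exact: nderivableD.
Qed.

Lemma smoothM {f g} : smooth f -> smooth g -> smooth (fun x => f x * g x).
Proof.
by move=> /smoothP fs /smoothP gs; apply/smoothP => k; exact: nderivableM.
Qed.

Lemma smoothN {f} : smooth f -> smooth (fun x => - f x).
Proof.
move=> fs; suff -> : (fun x => - f x) = (fun x => -1 * f x).
  exact: smoothM (smooth_cst _) fs.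
by apply/funext => x; rewrite mulN1r.
Qed.

Lemma smooth_sum {I} {r : seq I} {P : pred I} {F : I -> R -> R} :
  (forall i, P i -> smooth (F i)) -> smooth (fun x => \sum_(i <- r | P i) F i x).
Proof.
move=> Fs; elim: r => [|i r IHr].
  by rewrite (_ : (fun=> _) = fun=> 0); [exact: smooth_cst|apply/funext => x; rewrite big_nil].
have [Pi|/negbTE Pi] := boolP (P i); last first.
  by rewrite (_ : (fun=> _) = fun x => \sum_(i <- r | P i) F i x) //;
    apply/funext => x; rewrite big_cons Pi.
rewrite (_ : (fun=> _) = fun x => F i x + \sum_(i <- r | P i) F i x).
  exact: smoothD (Fs _ Pi) IHr.
by apply/funext => x; rewrite big_cons Pi.
Qed.

Lemma smooth_prod {I} {r : seq I} {F : I -> R -> R} :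
  (forall i, smooth (F i)) -> smooth (fun x => \prod_(i <- r) F i x).
Proof.
move=> Fs; elim: r => [|i r IHr].
  by rewrite (_ : (fun=> _) = fun=> 1); [exact: smooth_cst|apply/funext => x; rewrite big_nil].
rewrite (_ : (fun=> _) = fun x => F i x * \prod_(i <- r) F i x).
  exact: smoothM (Fs _) IHr.
by apply/funext => x; rewrite big_cons.
Qed.

(* The denominator is globally smooth but nonzero only near [x]: this class is
   stable under derivation, which is what makes smoothness local. *)
Definition locally_quotient g := forall x, exists a b : R -> R,
  [/\ smooth a, smooth b, b x != 0 & \forall y \near x, g y = a y * (b y)^-1].

Lemma smooth_neq0_near {f x} : smooth f -> f x != 0 -> \forall y \near x, f y != 0.
Proof.
move=> fs fx; have /differentiable_continuous fc : differentiable f x.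
  by apply/derivable1_diffP; exact: smooth_derivable.
apply: (fc [set y | y != 0]).
by apply: open_nbhs_nbhs; split => //; exact: open_neq.
Qed.

Lemma is_derive_quotient {a b : R -> R} {x} : smooth a -> smooth b -> b x != 0 ->
  is_derive x 1 (fun y => a y * (b y)^-1)
    ((derive1 a x * b x - a x * derive1 b x) * (b x * b x)^-1).
Proof.
move=> sa sb bx0.
have da := smooth_derivable x sa; have db := smooth_derivable x sb.
have dbV := derivableV bx0 db.
apply: DeriveDef; first exact: derivableM.
rewrite (deriveM da dbV) deriveV // !derive1E /GRing.scale /=.
by field.
Qed.

Lemma smooth_locally_quotient {g} : locally_quotient g -> smooth g.
Proof.
move=> gq; apply/smoothP => k; elim: k g gq => [//|k IHk] g gq.
have dg x (a b : R -> R) : smooth a -> smooth b -> b x != 0 ->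
    (\forall y \near x, g y = a y * (b y)^-1) ->
    is_derive x 1 g ((derive1 a x * b x - a x * derive1 b x) * (b x * b x)^-1).
  move=> sa sb bx gab; apply: near_eq_is_derive (is_derive_quotient sa sb bx).
  by near=> y; apply/esym; near: y.
split=> [x|].
  by have [a [b [sa sb bx /(dg x a b sa sb bx)[]]]] := gq x.
apply: IHk; move=> x; have [a [b [sa sb bx gab]]] := gq x.
exists (fun y => derive1 a y * b y - a y * derive1 b y), (fun y => b y * b y).
split.
- apply: smoothD; first exact: smoothM (smooth_derive1 sa) sb.
  by apply: smoothN; apply: smoothM sa (smooth_derive1 sb).
- exact: smoothM.
- by rewrite mulf_neq0.
(* The derivative formula is used at every y near x, so [gab] must hold on a neighbourhood of each
   such y. *)
- near=> y; rewrite derive1E; apply: derive_val; apply: dg => //.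
    by near: y; exact: smooth_neq0_near.
  by near: y; exact: nbhs_interior gab.
Unshelve. all: by end_near. Qed.

End Smooth.

(** * Matrix functions and the pseudoinverse *)

Section SmoothMatrices.
Context {R : realType}.

Lemma smooth_mx_cst {a b} (M : 'M[R]_(a, b)) : smooth_mx (fun=> M).
Proof. by move=> i j; exact: smooth_cst. Qed.

Lemma smooth_mxM {a b c} {F : R -> 'M[R]_(a, b)} {G : R -> 'M[R]_(b, c)} :
  smooth_mx F -> smooth_mx G -> smooth_mx (fun t => F t *m G t).
Proof.
move=> sF sG i j.
under [fun t => _]eq_fun do rewrite mxE.
by apply: smooth_sum => k _; exact: smoothM.
Qed.

Lemma smooth_mxD {a b} {F G : R -> 'M[R]_(a, b)} :
  smooth_mx F -> smooth_mx G -> smooth_mx (fun t => F t + G t).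
Proof.
by move=> sF sG i j; under [fun t => _]eq_fun do rewrite mxE; exact: smoothD.
Qed.

Lemma smooth_mxN {a b} {F : R -> 'M[R]_(a, b)} :
  smooth_mx F -> smooth_mx (fun t => - F t).
Proof.
by move=> sF i j; under [fun t => _]eq_fun do rewrite mxE; exact: smoothN.
Qed.

Lemma smooth_mx_tr {a b} {F : R -> 'M[R]_(a, b)} :
  smooth_mx F -> smooth_mx (fun t => (F t)^T).
Proof. by move=> sF i j; under [fun t => _]eq_fun do rewrite mxE; exact: sF. Qed.

Lemma smooth_mxd {a b} {F : R -> 'M[R]_(a, b)} : smooth_mx F -> smooth_mx (mxD F).
Proof.
by move=> sF i j; under [fun t => _]eq_fun do rewrite mxE; exact: smooth_derive1.
Qed.

Lemma smooth_mx_sum {a b} {I} {r : seq I} {P : pred I} {F : I -> R -> 'M[R]_(a, b)} :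
  (forall i, P i -> smooth_mx (F i)) ->
  smooth_mx (fun t => \sum_(i <- r | P i) F i t).
Proof.
move=> sF i j; under [fun t => _]eq_fun do rewrite summxE.
by apply: smooth_sum => k Pk; exact: sF.
Qed.

Lemma smooth_det {a} {F : R -> 'M[R]_a} : smooth_mx F -> smooth (fun t => \det (F t)).
Proof.
move=> sF; apply: smooth_sum => s _; apply: smoothM; first exact: smooth_cst.
by apply: smooth_prod => i; exact: sF.
Qed.

Lemma smooth_adj {a} {F : R -> 'M[R]_a} : smooth_mx F -> smooth_mx (fun t => \adj (F t)).
Proof.
move=> sF i j; under [fun t => _]eq_fun do rewrite mxE.
apply: smoothM; first exact: smooth_cst.
by apply: smooth_det => k l; under [fun t => _]eq_fun do rewrite !mxE; exact: sF.
Qed.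

Lemma smooth_invmx {a} {F : R -> 'M[R]_a} :
  smooth_mx F -> (forall t, F t \in unitmx) -> smooth_mx (fun t => invmx (F t)).
Proof.
move=> sF uF i j; apply: smooth_locally_quotient => x.
exists (fun t => \adj (F t) i j), (fun t => \det (F t)); split.
- exact: smooth_adj.
- exact: smooth_det.
- by rewrite -unitfE -unitmxE.
- by near=> t; rewrite /invmx uF mxE mulrC.
Unshelve. all: by end_near. Qed.

Lemma mxD_mul {a b c} {F : R -> 'M[R]_(a, b)} {G : R -> 'M[R]_(b, c)} :
  smooth_mx F -> smooth_mx G ->
  forall t, mxD (fun s => F s *m G s) t = mxD F t *m G t + F t *m mxD G t.
Proof.
move=> sF sG t; apply/matrixP => i j; rewrite !mxE.
under [fun s => _]eq_fun do rewrite mxE.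
rewrite derive1E.
have -> : (fun s => \sum_k F s i k * G s k j) =
    \sum_k (fun s => F s i k * G s k j) :> (R -> R).
  by apply/funext => s; rewrite fct_sumE.
rewrite derive_sum; last first.
  by move=> k; apply: derivableM; exact: smooth_derivable.
rewrite -big_split; apply: eq_bigr => k _; rewrite !mxE -derive1E derive1M //.
- by move=> x; exact: smooth_derivable.
- by move=> x; exact: smooth_derivable.
Qed.

Lemma mxD_add {a b} {F G : R -> 'M[R]_(a, b)} :
  smooth_mx F -> smooth_mx G ->
  forall t, mxD (fun s => F s + G s) t = mxD F t + mxD G t.
Proof.
move=> sF sG t; apply/matrixP => i j; rewrite !mxE.
under [fun s => _]eq_fun do rewrite mxE.
by rewrite derive1D // => x; exact: smooth_derivable.
Qed.

Lemma mxD_cst {a b} (M : 'M[R]_(a, b)) t : mxD (fun=> M) t = 0.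
Proof. by apply/matrixP => i j; rewrite !mxE derive1_cst. Qed.

Lemma mxD_mulmxl {a b c} (M : 'M[R]_(a, b)) {F : R -> 'M[R]_(b, c)} :
  smooth_mx F -> forall t, mxD (fun s => M *m F s) t = M *m mxD F t.
Proof.
by move=> sF t; rewrite mxD_mul ?mxD_cst ?mul0mx ?add0r //; exact: smooth_mx_cst.
Qed.

Lemma mxD_sum {a b} {I} {r : seq I} {F : I -> R -> 'M[R]_(a, b)} :
  (forall i, smooth_mx (F i)) ->
  forall t, mxD (fun s => \sum_(i <- r) F i s) t = \sum_(i <- r) mxD (F i) t.
Proof.
move=> sF t; elim: r => [|i r IHr].
  by rewrite big_nil; under [fun s => _]eq_fun do rewrite big_nil; exact: mxD_cst.
rewrite big_cons -IHr; under [fun s => _]eq_fun do rewrite big_cons.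
by rewrite mxD_add //; exact: smooth_mx_sum.
Qed.

Lemma bounded_mxD {a b} {F G : R -> 'M[R]_(a, b)} :
  bounded_mx F -> bounded_mx G -> bounded_mx (fun t => F t + G t).
Proof.
move=> [M HM] [N HN]; exists (M + N) => t i j; rewrite mxE.
exact: le_trans (ler_normD _ _) (lerD (HM _ _ _) (HN _ _ _)).
Qed.

(** Stated for single matrices, since it also bounds [fhat], which depends on more than time. *)
Lemma normr_mulmx_le {a b c} {F : 'M[R]_(a, b)} {G : 'M[R]_(b, c)} {M N : R} :
  (forall i j, `|F i j| <= M) -> (forall i j, `|G i j| <= N) ->
  forall i j, `|(F *m G) i j| <= \sum_(k < b) M * N.
Proof.
move=> HM HN i j; rewrite mxE; apply: le_trans (ler_norm_sum _ _ _) _.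
by apply: ler_sum => k _; rewrite normrM ler_pM.
Qed.

Lemma bounded_mxM {a b c} {F : R -> 'M[R]_(a, b)} {G : R -> 'M[R]_(b, c)} :
  bounded_mx F -> bounded_mx G -> bounded_mx (fun t => F t *m G t).
Proof.
move=> [M HM] [N HN]; exists (\sum_(k < b) M * N) => t.
exact: normr_mulmx_le.
Qed.

Lemma bounded_mx_cst {a b} (M : 'M[R]_(a, b)) : bounded_mx (fun=> M).
Proof.
exists (\sum_i \sum_j `|M i j|) => _ i j.
rewrite (bigD1 i) //= (bigD1 j) //= -addrA lerDl.
by rewrite addr_ge0 //; do ?[apply: sumr_ge0 => *].
Qed.

End SmoothMatrices.

(** * Moore-Penrose inverses: existence, uniqueness, smooth dependence *)

Section Pseudoinverse.
Context {R : realType}.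

(** The diagonal entries of [A^T *m A] are the sums of squares of the columns of [A]. *)
Lemma mulmx_tr_self_eq0 {a b} {A : 'M[R]_(a, b)} : A^T *m A = 0 -> A = 0.
Proof.
move=> AA; apply/matrixP => i j; have /matrixP/(_ j j) := AA; rewrite !mxE.
under eq_bigr do rewrite mxE -expr2.
move=> /eqP; rewrite psumr_eq0; last by move=> k _; exact: sqr_ge0.
by move=> /allP/(_ i (mem_index_enum _)); rewrite /= sqrf_eq0 => /eqP.
Qed.

Lemma mulmx_tr_cancel {a b c} {A : 'M[R]_(a, b)} {X Y : 'M[R]_(b, c)} :
  A^T *m A *m X = A^T *m A *m Y -> A *m X = A *m Y.
Proof.
move=> AXY; apply/eqP; rewrite -subr_eq0 -mulmxBr; apply/eqP.
apply: mulmx_tr_self_eq0; rewrite trmx_mul -mulmxA [A^T *m _]mulmxA.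
by rewrite mulmxBr AXY subrr mulmx0.
Qed.

(** [A *m X] and [A *m Y] are symmetric and each absorbs the other, hence they agree; so do [X *m A]
    and [Y *m A], and X = XAX = YAY = Y. *)
Lemma penrose_unique {a b} {A : 'M[R]_(a, b)} {X Y : 'M[R]_(b, a)} :
  penrose A X -> penrose A Y -> X = Y.
Proof.
move=> [AXA XAX AXs XAs] [AYA YAY AYs YAs].
have AXY : A *m X = A *m Y.
  by rewrite -AXs -{1}AYA -mulmxA trmx_mul AXs AYs mulmxA AXA.
have XYA : X *m A = Y *m A.
  by rewrite -XAs -{1}AYA -mulmxA mulmxA trmx_mul YAs XAs -mulmxA [A *m _]mulmxA AXA.
by rewrite -XAX -mulmxA AXY mulmxA XYA YAY.
Qed.

(* Zlobec's formula: any generalized inverse of [A^T A A^T] yields the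
   pseudoinverse of [A]. *)
Lemma penrose_ginv {a b} {A : 'M[R]_(a, b)} {Y : 'M[R]_(a, b)} :
  let M := A^T *m A *m A^T in M *m Y *m M = M -> penrose A (A^T *m Y *m A^T).
Proof.
move=> M MYM; set X := A^T *m Y *m A^T.
(* [MYM] loses its leading factor [A^T] here and its trailing one, after transposition, in [AXA]. *)
have e1 : A *m X *m (A *m A^T) = A *m A^T.
  rewrite -!mulmxA; apply: mulmx_tr_cancel.
  by move: MYM; rewrite /M /X !mulmxA.
have AXA : A *m X *m A = A.
  have := @mulmx_tr_cancel _ _ _ A^T (A *m X)^T 1%:M.
  rewrite trmxK !mulmx1 -trmx_mul => H; apply: trmx_inj; apply: H.
  by apply: trmx_inj; rewrite [LHS]trmx_mul trmxK trmx_mul trmxK e1.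
(* A matrix equal to its product with its own transpose is symmetric. *)
have AXs : (A *m X)^T = A *m X.
  have e : A *m X *m (A *m X)^T = A *m X.
    have -> : A *m X = A *m A^T *m Y *m A^T by rewrite /X !mulmxA.
    rewrite -[_ *m _ *m _^T]mulmxA -trmx_mul; congr (_ *m _^T).
    by move: AXA; rewrite /X !mulmxA.
  by rewrite -[RHS]e -{1}e trmx_mul trmxK.
have XAs : (X *m A)^T = X *m A.
  have e : (X *m A)^T *m (X *m A) = (X *m A)^T.
    have -> : (X *m A)^T = (Y *m A^T *m A)^T *m A.
      by rewrite /X -!mulmxA trmx_mul trmxK !mulmxA.
    by rewrite -mulmxA [A *m _]mulmxA AXA.
  have e' : X *m A = (X *m A)^T *m (X *m A).
    by rewrite -[LHS]trmxK -{1}e trmx_mul trmxK.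
  by rewrite [RHS]e' e.
split=> //.
rewrite -mulmxA {1}/X -mulmxA; congr (_ *m _).
by rewrite -{1}AXs -trmx_mul AXA.
Qed.

(** Zlobec's formula writes [A] as a product ending in the transpose of this cube, which bounds the
    rank of [A]. Constancy of the rank thus passes to the cube, as [smooth_mpinv] requires. *)
Lemma mxrank_tr_mul_tr {a b} (A : 'M[R]_(a, b)) : \rank (A^T *m A *m A^T) = \rank A.
Proof.
set M := _ *m _; apply/eqP; rewrite eqn_leq.
rewrite -{1}[\rank A]mxrank_tr mxrankM_maxr /=.
have := @penrose_ginv _ _ A (pinvmx M) (mulmxKpV (submx_refl M)).
move=> [AXA _ AXs _].
have {}AXA : A = A *m (pinvmx M)^T *m M^T.
  by rewrite -{1}AXA -AXs /M !trmx_mul !trmxK !mulmxA.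
by rewrite {1}AXA -[\rank M]mxrank_tr mxrankM_maxr.
Qed.

(** [pinvmx] supplies a generalized inverse of the cube, so a pseudoinverse exists and [xget] does
    not fall back on its default. *)
Lemma mpinvP {a b} (A : 'M[R]_(a, b)) : penrose A (mpinv A).
Proof.
set M := A^T *m A *m A^T.
have := @penrose_ginv _ _ A (pinvmx M) (mulmxKpV (submx_refl M)).
by move=> P; rewrite /mpinv; case: xgetP => [//|] /(_ _ P).
Qed.

Lemma mpinv_ginv {a b} {A Y : 'M[R]_(a, b)} :
  let M := A^T *m A *m A^T in M *m Y *m M = M -> mpinv A = A^T *m Y *m A^T.
Proof. by move=> M /penrose_ginv; exact: penrose_unique (mpinvP A). Qed.

(** [A *m mpinv A] projects onto the column space of [A]. Column inclusion is written with
    transposes because [<=] compares row spaces. *)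
Lemma mulmx_mpinv_id {a b c} {A : 'M[R]_(a, b)} {X : 'M[R]_(a, c)} :
  (X^T <= A^T)%MS -> A *m mpinv A *m X = X.
Proof.
move=> /submxP[D XE]; have [AXA _ _ _] := mpinvP A.
by rewrite -[X]trmxK XE trmx_mul trmxK mulmxA AXA.
Qed.

Lemma mulmx_mpinv_free {a b} {A : 'M[R]_(a, b)} :
  row_free A -> A *m mpinv A = 1%:M.
Proof.
move=> /row_freeP[D AD]; have [AXA _ _ _] := mpinvP A.
by rewrite -[LHS]mulmx1 -AD mulmxA AXA.
Qed.

(* If [S M Q] is invertible of the full size [\rank M], then the rows of [S M]
   already span those of [M], so [Q (S M Q)^-1 S] is a generalized inverse. *)
Lemma ginv_compression {a b q} {M : 'M[R]_(a, b)} {S : 'M[R]_(q, a)} {Q : 'M[R]_(b, q)} :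
  \rank M = q -> S *m M *m Q \in unitmx ->
  M *m (Q *m invmx (S *m M *m Q) *m S) *m M = M.
Proof.
move=> rM uM.
have rSM : \rank (S *m M) = q.
  apply/eqP; rewrite eqn_leq rank_leq_row /=.
  by rewrite -{1}(mxrank_unit uM) mxrankM_maxl.
have /submxP[Y ME] : (M <= S *m M)%MS.
  by rewrite -(geq_leqif (mxrank_leqif_sup (submxMl S M))) rM rSM.
have -> : M *m (Q *m invmx (S *m M *m Q) *m S) *m M =
          M *m Q *m invmx (S *m M *m Q) *m (S *m M) by rewrite !mulmxA.
have -> : M *m Q = Y *m (S *m M *m Q) by rewrite {1}ME !mulmxA.
by rewrite -[Y *m _ *m _]mulmxA mulmxV // mulmx1 -ME.
Qed.

(** [S] and [Q] are one-sided inverses of the factors in [M = col_base M *m row_base M]. *)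
Lemma mxrank_compression {a b} (M : 'M[R]_(a, b)) :
  exists (S : 'M[R]_(\rank M, a)) (Q : 'M[R]_(b, \rank M)), S *m M *m Q = 1%:M.
Proof.
have /row_freeP[Q HQ] := row_base_free M.
have /row_fullP[S HS] := col_base_full M.
exists S, Q.
have -> : S *m M = row_base M by rewrite -{3}(mulmx_base M) mulmxA HS mul1mx.
exact: HQ.
Qed.

(** The compression chosen at x stays invertible for t near x. As the rank is constant,
    [ginv_compression] and Zlobec's formula then express the entries as quotients over its
    determinant. *)
Lemma smooth_mpinv {a b} {F : R -> 'M[R]_(a, b)} q :
  smooth_mx F -> (forall t, \rank (F t) = q) -> smooth_mx (fun t => mpinv (F t)).
Proof.
move=> sF rF i j; apply: smooth_locally_quotient => x.
pose M t := (F t)^T *m F t *m (F t)^T.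
have [S [Q SMQ]] := mxrank_compression (M x).
have rM t : \rank (M t) = \rank (M x) by rewrite !mxrank_tr_mul_tr !rF.
have sM : smooth_mx M.
  exact: smooth_mxM (smooth_mxM (smooth_mx_tr sF) sF) (smooth_mx_tr sF).
have sG : smooth_mx (fun t => S *m M t *m Q).
  exact: smooth_mxM (smooth_mxM (smooth_mx_cst S) sM) (smooth_mx_cst Q).
have dx : \det (S *m M x *m Q) != 0 by rewrite SMQ det1 oner_neq0.
exists (fun t => ((F t)^T *m (Q *m \adj (S *m M t *m Q) *m S) *m (F t)^T) i j),
  (fun t => \det (S *m M t *m Q)); split => //.
- have sA := smooth_mxM (smooth_mxM (smooth_mx_cst Q) (smooth_adj sG)) (smooth_mx_cst S).
  exact: (smooth_mxM (smooth_mxM (smooth_mx_tr sF) sA) (smooth_mx_tr sF) i j).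
- exact: smooth_det.
- near=> t.
  have uM : S *m M t *m Q \in unitmx.
    rewrite unitmxE unitfE; near: t; exact: (smooth_neq0_near (smooth_det sG)).
  rewrite (mpinv_ginv (ginv_compression (rM t) uM)) /invmx uM.
  by rewrite -!(scalemxAr, scalemxAl) mxE mulrC.
Unshelve. all: by end_near. Qed.

End Pseudoinverse.

(** * Block rows and columns *)

Section Selection.
Context {R : realType}.

Lemma mxnE {a b} (M : 'M[R]_(a, b)) (i : 'I_a) (j : 'I_b) : mxn M i j = M i j.
Proof. by rewrite /mxn !valK. Qed.

Lemma mxn_ord {a b} (M : 'M[R]_(a, b)) {i j} (ia : (i < a)%N) (jb : (j < b)%N) :
  mxn M i j = M (Ordinal ia) (Ordinal jb).
Proof. exact: (mxnE M (Ordinal ia) (Ordinal jb)). Qed.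

Lemma mxn_row_oversize {a b} (M : 'M[R]_(a, b)) i j : (a <= i)%N -> mxn M i j = 0.
Proof. by move=> ai; rewrite /mxn insubF // ltnNge ai. Qed.

Lemma mxn_col_oversize {a b} (M : 'M[R]_(a, b)) i j : (b <= j)%N -> mxn M i j = 0.
Proof. by move=> bj; rewrite /mxn; case: insub => // i'; rewrite insubF // ltnNge bj. Qed.

(* Blocks are addressed by selection matrices: [sel a b o] keeps rows o, ..., o+a-1,
   read as zero beyond row b. *)
Definition sel (a b o : nat) : 'M[R]_(a, b) := \matrix_(i, j) (j == (o + i)%N :> nat)%:R.

Lemma sel_mulE {a b c} o (M : 'M[R]_(b, c)) (i : 'I_a) j :
  (sel a b o *m M) i j = mxn M (o + i) j.
Proof.
rewrite mxE; under eq_bigr do rewrite mxE.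
have [ob|bo] := ltnP (o + i) b; last first.
  rewrite mxn_row_oversize // big1 // => k _.
  by rewrite [_ == _]ltn_eqF ?mul0r // (leq_trans (ltn_ord k)).
rewrite (bigD1 (Ordinal ob)) //= eqxx mul1r big1 ?addr0; last first.
  by move=> k; rewrite -val_eqE /= => /negbTE ->; rewrite mul0r.
by rewrite -(mxnE M (Ordinal ob)).
Qed.

Lemma selT_mulE {a b c} o (M : 'M[R]_(a, c)) (i : 'I_b) j :
  ((sel a b o)^T *m M) i j = if (o <= i)%N then mxn M (i - o) j else 0.
Proof.
rewrite mxE; under eq_bigr do rewrite !mxE.
case: leqP => [oi|io]; last first.
  by rewrite big1 // => k _; rewrite ltn_eqF ?mul0r //; lia.
have [ib|bi] := ltnP (i - o) a; last first.
  rewrite mxn_row_oversize // big1 // => k _; rewrite [_ == _](_ : _ = false) ?mul0r //.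
  by have := ltn_ord k; lia.
rewrite (bigD1 (Ordinal ib)) //= subnKC // eqxx mul1r big1 ?addr0; last first.
  move=> k; rewrite -val_eqE /= => ki; rewrite [_ == _](_ : _ = false) ?mul0r //; lia.
by rewrite -(mxnE M (Ordinal ib)).
Qed.

Lemma mxn_tr {a b} (M : 'M[R]_(a, b)) i j : mxn M^T i j = mxn M j i.
Proof. by rewrite /mxn; case: insub => [?|]; case: insub => [?|] //; rewrite mxE. Qed.

Lemma mul_selTE {a b c} o (M : 'M[R]_(c, b)) i (j : 'I_a) :
  (M *m (sel a b o)^T) i j = mxn M i (o + j).
Proof. by rewrite -[M]trmxK -trmx_mul mxE sel_mulE mxn_tr trmxK. Qed.

Lemma sel_selT {a a' b o o'} : (o' + a' <= b)%N ->
  sel a b o *m (sel a' b o')^T = \matrix_(i, j) ((o' + j)%N == (o + i)%N)%:R.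
Proof.
move=> ob; apply/matrixP => i j; rewrite mul_selTE mxE.
have jb : (o' + j < b)%N by have := ltn_ord j; lia.
by rewrite (mxn_ord _ (ltn_ord i) jb) mxE /=.
Qed.

Lemma sel_selT_id {a b o} : (o + a <= b)%N -> sel a b o *m (sel a b o)^T = 1%:M.
Proof.
by move=> ob; rewrite sel_selT //; apply/matrixP => i j; rewrite !mxE eqn_add2l eq_sym.
Qed.

Lemma sel_selT_eq0 {a a' b o o'} : (o' + a' <= b)%N ->
  (o + a <= o')%N || (o' + a' <= o)%N -> sel a b o *m (sel a' b o')^T = 0.
Proof.
move=> ob oo; rewrite sel_selT //; apply/matrixP => i j; rewrite !mxE.
by rewrite [_ == _](_ : _ = false) //; have := ltn_ord i; have := ltn_ord j; lia.
Qed.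

Section Blocks.
Context {p : nat} (r : nat).

Definition bsel (k : nat) : 'M[R]_(p, r * p) := sel p (r * p) (k * p).
Definition blockcol {n} (W : nat -> 'M[R]_(p, n)) : 'M[R]_(r * p, n) :=
  \sum_(k < r) (bsel k)^T *m W k.
Definition blockrow {n} (W : nat -> 'M[R]_(n, p)) : 'M[R]_(n, r * p) :=
  \sum_(k < r) W k *m bsel k.

Lemma block_lt {k} : (k < r)%N -> (k * p + p <= r * p)%N.
Proof. by move=> kr; rewrite -mulSnr leq_mul2r kr orbT. Qed.

Lemma bsel_bselT k l : (l < r)%N -> bsel k *m (bsel l)^T = if k == l then 1%:M else 0.
Proof.
move=> lr; case: eqP => [->|kl]; first by rewrite sel_selT_id // block_lt.
by rewrite sel_selT_eq0 ?block_lt // -!mulSnr !leq_mul2r; lia.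
Qed.

Lemma blockcolE {n} (W : nat -> 'M[R]_(p, n)) i j :
  blockcol W i j = mxn (W (i %/ p)%N) (i %% p)%N j.
Proof.
have p0 : (0 < p)%N by case: p i => [|//]; rewrite muln0 => -[].
have kr : (i %/ p < r)%N by rewrite ltn_divLR.
rewrite summxE (bigD1 (Ordinal kr)) //= selT_mulE leq_trunc_div.
have -> : (i - i %/ p * p = i %% p)%N by rewrite {1}(divn_eq i p) addKn.
(* Blocks after number [i %/ p] start beyond row [i]; earlier ones are read past their last row and
   give zero. *)
rewrite big1 ?addr0 // => k; rewrite -val_eqE /= => ki.
rewrite selT_mulE; case: leqP => // kpi; rewrite mxn_row_oversize //.
have : (k < i %/ p)%N by rewrite ltn_neqAle ki leq_divRL.
move=> kq; have := leq_trans (leq_mul kq (leqnn p)) (leq_trunc_div i p).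
by rewrite mulSn; lia.
Qed.

Lemma blockrowE {n} (W : nat -> 'M[R]_(n, p)) i j :
  blockrow W i j = mxn (W (j %/ p)%N) i (j %% p)%N.
Proof.
have -> : blockrow W = (blockcol (fun k => (W k)^T))^T.
  by rewrite raddf_sum /=; apply: eq_bigr => k _; rewrite trmx_mul !trmxK.
by rewrite mxE blockcolE mxn_tr.
Qed.

Lemma bsel_blockcol {n} (W : nat -> 'M[R]_(p, n)) k : (k < r)%N ->
  bsel k *m blockcol W = W k.
Proof.
move=> kr; rewrite mulmx_sumr (bigD1 (Ordinal kr)) //= mulmxA bsel_bselT // eqxx mul1mx.
rewrite big1 ?addr0 // => l; rewrite -val_eqE /= => lk.
by rewrite mulmxA bsel_bselT // eq_sym (negbTE lk) mul0mx.
Qed.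

Lemma blockrow_bselT {n} (W : nat -> 'M[R]_(n, p)) k : (k < r)%N ->
  blockrow W *m (bsel k)^T = W k.
Proof.
move=> kr; rewrite mulmx_suml (bigD1 (Ordinal kr)) //= -mulmxA bsel_bselT // eqxx mulmx1.
rewrite big1 ?addr0 // => l; rewrite -val_eqE /= => lk.
by rewrite -mulmxA bsel_bselT // (negbTE lk) mulmx0.
Qed.

Lemma sum_bselT_bsel : \sum_(k < r) (bsel k)^T *m bsel k = 1%:M.
Proof.
apply/matrixP => i j; rewrite -/(blockcol bsel) blockcolE.
have p0 : (0 < p)%N by case: p i {j} => [|//]; rewrite muln0 => -[].
by rewrite (mxn_ord _ (ltn_pmod i p0) (ltn_ord j)) !mxE -divn_eq eq_sym.
Qed.

End Blocks.
End Selection.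
Arguments sel {R}.
Arguments bsel {R p}.

(** * The matrices of the statement as block sums *)

Section BlockForms.
Context {R : realType}.

Lemma calC_blockcol {n p} r (A : 'M[R]_n) (C : 'M[R]_(p, n)) :
  calC r A C = blockcol r (fun k => C *m A ^+ k).
Proof. by apply/matrixP => i j; rewrite blockcolE mxE. Qed.

Lemma calB_blockrow {n m} r (A : 'M[R]_n) (B : 'M[R]_(n, m)) (L : R -> 'M[R]_m) t :
  calB r A B L t = blockrow r (fun k => BLk A B L k t).
Proof. by apply/matrixP => i j; rewrite blockrowE mxE. Qed.

Lemma E_last_bsel p r : E_last R p r = (bsel r r.-1)^T.
Proof. by apply/matrixP => i j; rewrite !mxE. Qed.

Lemma Umx_sel {n m p} r (A : 'M[R]_n) (B : 'M[R]_(n, m)) (C : 'M[R]_(p, n))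
    (L : R -> 'M[R]_m) (V : 'M[R]_(n, n - p * r)) t :
  Umx r A B C L V t = (sel (r * p) n 0)^T *m calC r A C
                      + (sel (n - p * r) n (r * p))^T *m calN r A B C L V t.
Proof.
apply/matrixP => i j; rewrite !mxE -!/(_ *m _) /=.
have := selT_mulE 0 (calC r A C) i j; rewrite mxE subn0 /= => ->.
have := selT_mulE (r * p) (calN r A B C L V t) i j; rewrite mxE => ->.
case: ltnP => irp; first by rewrite addr0.
by rewrite (mxn_row_oversize (calC r A C)) // add0r.
Qed.

End BlockForms.

(** * The operator d/dt - A and the relative degree *)

Section Dynamics.
Context {R : realType} {n : nat} (A : 'M[R]_n).

(** The iterates of d/dt - A on an arbitrary [W]: besides [B *m L t] they are applied to the factor
    [F] of the case q = p. *)
Fixpoint dA {m} (W : R -> 'M[R]_(n, m)) (k : nat) : R -> 'M[R]_(n, m) :=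
  if k is k'.+1 then fun t => mxD (dA W k') t - A *m dA W k' t else W.

Lemma BLk_dA {m} (B : 'M[R]_(n, m)) (L : R -> 'M[R]_m) k :
  BLk A B L k = dA (fun t => B *m L t) k.
Proof. by elim: k => //= k ->. Qed.

Lemma smooth_dA {m} {W : R -> 'M[R]_(n, m)} k : smooth_mx W -> smooth_mx (dA W k).
Proof.
move=> sW; elim: k => //= k IHk.
exact: smooth_mxD (smooth_mxd IHk) (smooth_mxN (smooth_mxM (smooth_mx_cst A) IHk)).
Qed.

Definition dArow {m} (r : nat) (W : R -> 'M[R]_(n, m)) (t : R) : 'M[R]_(n, r * m) :=
  blockrow r (fun k => dA W k t).

Lemma smooth_dArow {m} {r} {W : R -> 'M[R]_(n, m)} : smooth_mx W -> smooth_mx (dArow r W).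
Proof.
move=> sW; apply: smooth_mx_sum => k _.
exact: smooth_mxM (smooth_dA k sW) (smooth_mx_cst _).
Qed.

Section RelativeDegree.
Context {p m r : nat} (C : 'M[R]_(p, n)) {W : R -> 'M[R]_(n, m)}.
Hypothesis sW : smooth_mx W.
Hypothesis CAW : forall k, (k < r.-1)%N -> forall t, C *m A ^+ k *m W t = 0.

(** Since C A^i (d/dt - A) X = d/dt (C A^i X) - C A^(i+1) X, one application of the operator is
    traded for one power of [A]; the differentiated term is zero by induction. *)
Lemma CA_dA_eq0 j i t : (i + j < r.-1)%N -> C *m A ^+ i *m dA W j t = 0.
Proof.
elim: j i t => [|j IHj] i t ij /=; first by apply: CAW; rewrite addn0 in ij.
rewrite mulmxBr -mxD_mulmxl; last exact: smooth_dA.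
rewrite (_ : (fun s => _) = fun=> 0); last by apply/funext => s; apply: IHj; lia.
rewrite mxD_cst sub0r mulmxA -[C *m A ^+ i *m A]mulmxA mulmxE -exprSr IHj ?oppr0 //.
by lia.
Qed.

(** The same trade: the differentiated term vanishes by [CA_dA_eq0], and each application
    contributes a sign. *)
Lemma CA_dA_antidiag j i t : (i + j = r.-1)%N ->
  C *m A ^+ i *m dA W j t = (-1) ^+ j *: (C *m A ^+ r.-1 *m W t).
Proof.
elim: j i t => [|j IHj] i t ij /=; first by rewrite scale1r -ij addn0.
rewrite mulmxBr -mxD_mulmxl; last exact: smooth_dA.
rewrite (_ : (fun s => _) = fun=> 0); last by apply/funext => s; apply: CA_dA_eq0; lia.
rewrite mxD_cst sub0r mulmxA -[C *m A ^+ i *m A]mulmxA mulmxE -exprSr IHj; last by lia.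
by rewrite exprS mulN1r scaleNr.
Qed.

Hypothesis rkG : forall t, \rank (C *m A ^+ r.-1 *m W t) = p.

(* [calC * dArow] is block triangular along the antidiagonal, whose blocks
   are [+-Gamma W]. *)
Lemma row_free_calC_dArow t : row_free (calC r A C *m dArow r W t).
Proof.
apply: inj_row_free => v vM.
have vk j : (j < r)%N -> \sum_(k < r) v *m (bsel r k)^T *m (C *m A ^+ k *m dA W j t) = 0.
  move=> jr; transitivity (v *m (calC r A C *m dArow r W t) *m (bsel r j)^T).
    rewrite -!mulmxA blockrow_bselT // calC_blockcol !mulmxA /blockcol !mulmx_sumr mulmx_suml.
    by apply: eq_bigr => k _; rewrite !mulmxA.
  by rewrite vM mul0mx.
(* The blocks of [v] vanish from the last to the first. In column block j, the matrix blocks with k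
   + j < r - 1 are zero, the blocks of [v] after number r - 1 - j are zero by induction, and what
   remains is multiplied by +-Gamma W, of full row rank. *)
have v0 j : (j < r)%N -> v *m (bsel r (r.-1 - j))^T = 0.
  elim/ltn_ind: j => j IHj jr.
  have kr : (r.-1 - j < r)%N by lia.
  have := vk j jr; rewrite (bigD1 (Ordinal kr)) //= big1 ?addr0; last first.
    move=> k; rewrite -val_eqE /= => kj; have := ltn_ord k => {}kr.
    have [kj'|kj'] := ltnP (k + j) r.-1; first by rewrite CA_dA_eq0 // mulmx0.
    rewrite (_ : nat_of_ord k = r.-1 - (r.-1 - k))%N; last by lia.
    by rewrite IHj ?mul0mx //; lia.
  rewrite CA_dA_antidiag; last by lia.
  rewrite -scalemxAr => /eqP; rewrite scaler_eq0 signr_eq0 /= => /eqP vG.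
  apply: (row_free_inj (A := C *m A ^+ r.-1 *m W t)); first by rewrite -row_leq_rank rkG.
  by rewrite vG mul0mx.
rewrite -[v]mulmx1 -sum_bselT_bsel mulmx_sumr big1 // => k _; rewrite mulmxA.
rewrite (_ : nat_of_ord k = r.-1 - (r.-1 - k))%N; last by have := ltn_ord k; lia.
by rewrite v0 ?mul0mx //; have := ltn_ord k; lia.
Qed.

(** When [W] is [B *m L t], these are the first [r * p] columns of the inverse of [U]. *)
Definition rinvC (t : R) : 'M[R]_(n, r * p) :=
  dArow r W t *m mpinv (calC r A C *m dArow r W t).

Lemma calC_rinvC t : calC r A C *m rinvC t = 1%:M.
Proof. by rewrite mulmxA mulmx_mpinv_free // row_free_calC_dArow. Qed.

Lemma smooth_rinvC : smooth_mx rinvC.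
Proof.
have sB : smooth_mx (dArow r W) by exact: smooth_dArow.
apply: (smooth_mxM sB); apply: (smooth_mpinv (r * p)).
  exact: smooth_mxM (smooth_mx_cst _) sB.
by move=> t; apply/eqP; exact: row_free_calC_dArow.
Qed.

End RelativeDegree.
Arguments rinvC {p m} r C W t.

(** Iteration of the Leibniz rule (d/dt - A)(X H) = ((d/dt - A) X) H + X H'. *)
Lemma dA_mul_span {p m} {F : R -> 'M[R]_(n, p)} {G : R -> 'M[R]_(p, m)} :
  smooth_mx F -> smooth_mx G -> forall j, exists H : nat -> R -> 'M[R]_(p, m),
    (forall i, smooth_mx (H i)) /\
    forall t, dA (fun s => F s *m G s) j t = \sum_(i < j.+1) dA F i t *m H i t.
Proof.
move=> sF sG; elim=> [|j [H [sH dH]]].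
  by exists (fun=> G); split=> // t; rewrite big_ord_recl big_ord0 addr0.
(* [H1] collects the terms where the operator acts on [dA F i], [H0] those where the coefficient is
   differentiated; the latter do not reach the new top index j + 1. *)
pose H0 i := if (i < j.+1)%N then mxD (H i) else fun=> 0.
pose H1 i := if i is i'.+1 then H i' else fun=> 0.
exists (fun i t => H1 i t + H0 i t); split.
  move=> i; apply: smooth_mxD.
    by case: i => [|i]; [exact: smooth_mx_cst|exact: sH].
  by rewrite /H0; case: ifP => _; [exact: smooth_mxd|exact: smooth_mx_cst].
move=> t /=; rewrite (_ : dA _ j = fun s => \sum_(i < j.+1) dA F i s *m H i s); last exact/funext.
rewrite mxD_sum; last by move=> i; exact: smooth_mxM (smooth_dA i sF) (sH i).
rewrite mulmx_sumr -sumrB.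
under [RHS]eq_bigr do rewrite mulmxDr.
rewrite [RHS]big_split /= [X in _ = X + _]big_ord_recl [X in _ = _ + X]big_ord_recr /=.
rewrite mulmx0 add0r /H0 ltnn mulmx0 addr0 -big_split; apply: eq_bigr => i _ /=.
rewrite ltn_ord mxD_mul; [|exact: smooth_dA|exact: sH].
by rewrite mulmxBl !mulmxA addrAC.
Qed.

Lemma bsel_calC_dArow {p m r} (C : 'M[R]_(p, n)) (W : R -> 'M[R]_(n, m)) k t : (k < r)%N ->
  bsel r k *m (calC r A C *m dArow r W t) = C *m A ^+ k *m dArow r W t.
Proof. by move=> kr; rewrite mulmxA calC_blockcol bsel_blockcol. Qed.

(** * The case q = p *)

Section SquareCase.
Context {p m r : nat} (C : 'M[R]_(p, n)) {W : R -> 'M[R]_(n, m)}.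
Hypothesis sW : smooth_mx W.
Hypothesis CAW : forall k, (k < r.-1)%N -> forall t, C *m A ^+ k *m W t = 0.
Hypothesis rkG : forall t, \rank (C *m A ^+ r.-1 *m W t) = p.
Hypothesis r0 : (0 < r)%N.
Hypothesis rkW : forall t, \rank (W t) = p.

(** With G = C A^(r-1) W, take F = W G^+. The rows of G lie in the row space of [W] and both ranks
    are [p], so W = X G for some X, and W G^+ G = W. *)
Lemma rank_factorization : exists F : R -> 'M[R]_(n, p),
  [/\ smooth_mx F, W = fun t => F t *m (C *m A ^+ r.-1 *m W t),
      (forall k, (k < r.-1)%N -> forall t, C *m A ^+ k *m F t = 0)
    & forall t, C *m A ^+ r.-1 *m F t = 1%:M].
Proof.
have fG t : row_free (C *m A ^+ r.-1 *m W t) by rewrite -row_leq_rank rkG.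
exists (fun t => W t *m mpinv (C *m A ^+ r.-1 *m W t)); split.
- apply: (smooth_mxM sW); apply: (smooth_mpinv p) => //.
  exact: smooth_mxM (smooth_mx_cst _) sW.
- apply/funext => t.
  have /submxP[X WE] : (W t <= C *m A ^+ r.-1 *m W t)%MS.
    by rewrite -(geq_leqif (mxrank_leqif_sup (submxMl _ _))) rkW rkG.
  have [] := mpinvP (C *m A ^+ r.-1 *m W t).
  move: WE; move: (C *m _ *m _) => G WE GGG _ _ _.
  by rewrite WE -!mulmxA [G *m (_ *m _)]mulmxA GGG.
- by move=> k kr t; rewrite mulmxA CAW // mul0mx.
- by move=> t; rewrite mulmxA mulmx_mpinv_free.
Qed.

(** By [dA_mul_span], block j involves only the blocks i <= j of [dArow r F]. *)
Lemma dArow_mul_sub {F : R -> 'M[R]_(n, p)} {G : R -> 'M[R]_(p, m)} t :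
  smooth_mx F -> smooth_mx G ->
  ((dArow r (fun s => F s *m G s) t)^T <= (dArow r F t)^T)%MS.
Proof.
move=> sF sG; rewrite raddf_sum /=; apply: summx_sub => j _.
have [H [_ ->]] := dA_mul_span sF sG j.
rewrite trmx_mul mulmx_sub // raddf_sum /=; apply: summx_sub => i _.
rewrite trmx_mul mulmx_sub // -(blockrow_bselT r (fun k => dA F k t)).
  by rewrite trmx_mul submxMl.
by have := ltn_ord i; have := ltn_ord j; lia.
Qed.

(* For [q = p] the blocks of [F] already span those of [W]; [calC * dArow r F] is
   then square with first block row [0, ..., 0, +-I], which determines the last
   block row of its inverse [Y]. *)
Lemma rinvC_square : exists (F : R -> 'M[R]_(n, p)) (Y : R -> 'M[R]_(r * p)),
  [/\ smooth_mx F,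
      forall t, W t = F t *m (C *m A ^+ r.-1 *m W t),
      forall t, rinvC r C W t = dArow r F t *m Y t,
      forall t, Y t *m (calC r A C *m dArow r F t) = 1%:M
    & forall t k, (0 < k < r)%N -> bsel r r.-1 *m Y t *m (bsel r k)^T = 0].
Proof.
have [F [sF WE CAF CAF1]] := rank_factorization.
have sG : smooth_mx (fun t => C *m A ^+ r.-1 *m W t).
  exact: smooth_mxM (smooth_mx_cst _) sW.
have /choice[T TE] t : exists T, dArow r W t = dArow r F t *m T.
  have := dArow_mul_sub t sF sG; rewrite -WE => /submxP[D DE].
  by exists D^T; apply: trmx_inj; rewrite trmx_mul trmxK.
pose Y t := T t *m mpinv (calC r A C *m dArow r W t).
have ZE t : rinvC r C W t = dArow r F t *m Y t by rewrite /rinvC mulmxA -TE.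
have CY t : calC r A C *m dArow r F t *m Y t = 1%:M.
  by rewrite -mulmxA -ZE calC_rinvC.
exists F, Y; split => //.
- by move=> t; rewrite {1}WE.
- by move=> t; exact: mulmx1C.
move=> t k /andP[k0 kr].
have CF : bsel r 0 *m (calC r A C *m dArow r F t) = (-1) ^+ r.-1 *: bsel r r.-1.
  have r1 : (r.-1 < r)%N by rewrite prednK.
  rewrite bsel_calC_dArow // mulmx_sumr (bigD1 (Ordinal r1)) //= big1 ?addr0; last first.
    move=> l; rewrite -val_eqE /= => lr; rewrite mulmxA (CA_dA_eq0 (r := r) C sF CAF _ 0) ?mul0mx //.
    by have := ltn_ord l; lia.
  by rewrite mulmxA (CA_dA_antidiag (r := r) C sF CAF r.-1 0) // CAF1 -scalemxAl mul1mx.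
(* Multiplication by [Y t] turns the left side into the first block row of the identity, whose block
   k > 0 is zero. *)
have /(congr1 (fun X => X *m Y t *m (bsel r k)^T)) := CF.
rewrite -[_ *m _ *m Y t]mulmxA CY mulmx1 bsel_bselT // ltn_eqF // -!scalemxAl.
by move/esym/eqP; rewrite scaler_eq0 signr_eq0 => /eqP.
Qed.

(** With [X = mpinv V] the local [N] is [calN]. The first claim then kills the last block of the
    input matrix, the second kills P_2, ..., P_r, block [l] being P_(l+1). *)
Lemma calN_square_case {k} (X : 'M[R]_(k, n)) :
  let N := fun t => X *m (1%:M - rinvC r C W t *m calC r A C) in
  (forall t, N t *m W t = 0) /\
  (forall t l, (0 < l < r)%N ->
    (N t *m A + mxD N t) *m rinvC r C W t *m (bsel r l)^T = 0).
Proof.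
move=> N; have [F [Y [sF WE ZE YC Yl]]] := rinvC_square.
have sN : smooth_mx N.
  apply: (smooth_mxM (smooth_mx_cst _)); apply: (smooth_mxD (smooth_mx_cst _)).
  apply: smooth_mxN; apply: smooth_mxM (smooth_mx_cst _).
  exact: smooth_rinvC.
(* [rinvC r C W t *m calC r A C] fixes [dArow r F t], because [Y t] inverts
   [calC r A C *m dArow r F t]. *)
have NF t j : (j < r)%N -> N t *m dA F j t = 0.
  move=> jr; rewrite -(blockrow_bselT r (fun k => dA F k t)) // mulmxA.
  rewrite -/(dArow r F t) /N -[X *m _ *m _]mulmxA mulmxBl mul1mx ZE.
  by rewrite -!mulmxA YC mulmx1 subrr mul0mx mulmx0.
(* Differentiate N X = 0 for X = (d/dt - A)^j F: here X' = A X + (d/dt - A)^(j+1) F, and [N]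
   annihilates the last term too. *)
have NAF t j : (j.+1 < r)%N -> (N t *m A + mxD N t) *m dA F j t = 0.
  move=> jr; have := mxD_mul sN (smooth_dA j sF) t.
  rewrite (_ : (fun s => _) = fun=> 0); last by apply/funext => s; rewrite NF // ltnW.
  have := NF t _ jr; rewrite /= mulmxBr mxD_cst => /eqP; rewrite subr_eq0 => /eqP ->.
  by rewrite mulmxDl mulmxA addrC => <-.
split=> [t|t l lr]; first by rewrite WE mulmxA (NF t 0%N) // mul0mx.
(* Only the last block of [dArow r F t] escapes [NAF]; it meets the last block row of [Y t], whose
   block [l] is zero by [Yl]. *)
rewrite ZE /dArow /blockrow mulmxA mulmx_sumr !mulmx_suml big1 // => j _.
have [jr|rj] := ltnP j.+1 r; first by rewrite mulmxA NAF // !mul0mx.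
have -> : nat_of_ord j = r.-1 by have := ltn_ord j; lia.
by rewrite mulmxA -!mulmxA [bsel _ _ *m _]mulmxA Yl // !mulmx0.
Qed.

End SquareCase.

End Dynamics.
Arguments rinvC {R n} A {p m} r C W t.

(** * Continuity and stacked forms *)

Section MatrixContinuity.
Context {R : realType} {T : topologicalType}.

(** Entrywise neighbourhoods generate those of a matrix, and the entries are finite in number. *)
Lemma continuous_mxP {a b} {F : T -> 'M[R]_(a, b)} :
  (forall i j, continuous (fun x => F x i j)) -> continuous F.
Proof.
move=> cF x P [Q HQ sQP].
have nQ : \forall y \near x, forall i j, Q i j (F y i j).
  apply: filter_forall => i; apply: filter_forall => j.
  exact: cF.
by apply: filterS nQ => y; exact: sQP.
Qed.

Lemma continuous_mulmx {a b c} {F : T -> 'M[R]_(a, b)} {G : T -> 'M[R]_(b, c)} :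
  continuous F -> continuous G -> continuous (fun x => F x *m G x).
Proof.
move=> cF cG; apply: continuous_mxP => i j; under [fun x => _]eq_fun do rewrite mxE.
apply: continuous_big => [|k _ x]; first exact: add_continuous.
apply: continuousM; apply: (@continuous_comp _ _ _ _ (fun M : 'M[R]_(_, _) => M _ _)).
- exact: cF.
- exact: coord_continuous.
- exact: cG.
- exact: coord_continuous.
Qed.

End MatrixContinuity.

Lemma smooth_mx_continuous {R : realType} {a b} {F : R -> 'M[R]_(a, b)} :
  smooth_mx F -> continuous F.
Proof.
move=> sF; apply: continuous_mxP => i j x.
apply: differentiable_continuous; apply/derivable1_diffP.
exact: smooth_derivable (sF i j).
Qed.

(** * Reading off the blocks of the normal form *)

Section StackedForms.
Context {R : realType}.

Lemma sel_sel {a b c o o'} : (o + a <= b)%N ->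
  @sel R a b o *m sel b c o' = sel a c (o' + o).
Proof.
move=> ob; apply/matrixP => i j; rewrite sel_mulE.
have ib : (o + i < b)%N by have := ltn_ord i; lia.
by rewrite (mxn_ord _ ib (ltn_ord j)) !mxE addnA.
Qed.

Lemma mxn_sel_mul {a b c o} (M : 'M[R]_(b, c)) {i j} : (i < a)%N -> (j < c)%N ->
  mxn (sel a b o *m M) i j = mxn M (o + i) j.
Proof. by move=> ia jc; rewrite (mxn_ord _ ia jc) sel_mulE. Qed.

Lemma mxn_sel_mul_selT {a a' b b' o o'} (M : 'M[R]_(b, b')) {i j} :
  (i < a)%N -> (j < a')%N ->
  mxn (sel a b o *m M *m (sel a' b' o')^T) i j = mxn M (o + i) (o' + j).
Proof.
move=> ia ja; rewrite (mxn_ord _ ia ja) mul_selTE /=.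
have [jb|bj] := ltnP (o' + j) b'; last by rewrite !mxn_col_oversize.
by rewrite mxn_sel_mul.
Qed.

Context {n p r : nat} (r0 : (0 < r)%N) (prn : (p * r <= n)%N).

(** The other blocks are cut out of [M] itself, so only the shift rows impose a condition. *)
Lemma Aform_sel (M : 'M[R]_n) :
  (forall i j : 'I_n, (i < p * r.-1)%N -> M i j = (j == i + p :> nat)%N%:R) ->
  forall i j : 'I_n, M i j =
    Aform (fun k : 'I_r => sel p n (p * r.-1) *m M *m (sel p n (p * k))^T)
      (sel p n (p * r.-1) *m M *m (sel (n - p * r) n (p * r))^T)
      (fun k : 'I_r => sel (n - p * r) n (p * r) *m M *m (sel p n (p * k))^T)
      (sel (n - p * r) n (p * r) *m M *m (sel (n - p * r) n (p * r))^T) i j.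
Proof.
move=> shift i j; have hi := ltn_ord i; have hj := ltn_ord j.
have pr : (p * r = p * r.-1 + p)%N by rewrite -{1}(prednK r0) mulnS addnC.
have jp (jpr : (j < p * r)%N) :
    exists k : 'I_r, insub (j %/ p)%N = Some k /\ (p * k + j %% p = j)%N /\ (j %% p < p)%N.
  have p0 : (0 < p)%N by case: (p) jpr.
  have kr : (j %/ p < r)%N by rewrite ltn_divLR // mulnC.
  by exists (Ordinal kr); rewrite insubT ltn_pmod // mulnC -divn_eq.
rewrite /Aform; case: ltnP => i1; first exact: shift.
case: ltnP => i2; case: ltnP => j2.
- have [k [-> [kE jm]]] := jp j2.
  by rewrite mxn_sel_mul_selT ?subnKC ?kE ?mxnE //; lia.
- by rewrite mxn_sel_mul_selT ?subnKC ?mxnE //; lia.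
- have [k [-> [kE jm]]] := jp j2.
  by rewrite mxn_sel_mul_selT ?subnKC ?kE ?mxnE //; lia.
- by rewrite mxn_sel_mul_selT ?subnKC ?mxnE //; lia.
Qed.

Lemma stacked_sel {c} (X : 'M[R]_(n, c)) :
  (forall (i : 'I_n) j, (i < p * r.-1)%N -> X i j = 0) ->
  forall (i : 'I_n) (j : 'I_c), X i j =
    if (i < p * r.-1)%N then 0
    else if (i < p * r)%N then mxn (sel p n (p * r.-1) *m X) (i - p * r.-1)%N j
    else mxn (sel (n - p * r) n (p * r) *m X) (i - p * r)%N j.
Proof.
move=> X0 i j; have hi := ltn_ord i; have hj := ltn_ord j.
have pr : (p * r = p * r.-1 + p)%N by rewrite -{1}(prednK r0) mulnS addnC.
case: ltnP => i1; first exact: X0.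
by case: ltnP => i2; rewrite mxn_sel_mul ?subnKC ?mxnE //; lia.
Qed.

End StackedForms.

Theorem theorem1 (R : realType) (n m p : nat)
  (A : 'M[R]_n) (B : 'M[R]_(n, m)) (C : 'M[R]_(p, n))
  (L : R -> 'M[R]_m) (f : R -> 'cV[R]_n -> 'cV[R]_m -> 'cV[R]_n)
  (q r : nat) (V : 'M[R]_(n, n - p * r)) :
  (p <= m)%N ->
  (* f continuous and bounded *)
  continuous (fun z : R * 'cV[R]_n * 'cV[R]_m => f z.1.1 z.1.2 z.2) ->
  (exists M : R, forall t x u i j, `|f t x u i j| <= M) ->
  (* (P1) *)
  smooth_mx L ->
  (forall k, (k <= n)%N -> bounded_mx (iter k (@mxD R m m) L)) ->
  (forall t, \rank (B *m L t) = q) -> (p <= q)%N ->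
  (* (P2) *)
  (0 < r)%N ->
  (forall k, (k < r.-1)%N -> forall t, C *m A ^+ k *m B *m L t = 0) ->
  (forall k, (k < r.-1)%N -> forall t x u, C *m A ^+ k *m f t x u = 0) ->
  (forall t, \rank (C *m A ^+ r.-1 *m B *m L t) = p) ->
  (* V : im V = ker calC *)
  (V^T == kermx (calC r A C)^T)%MS ->
  (* U is a Lyapunov transformation *)
  lyapunov (Umx r A B C L V) ->
  let U := Umx r A B C L V in
  let Gamma := C *m A ^+ r.-1 *m B in
  let Ahat := fun t => (U t *m A + mxD U t) *m invmx (U t) in
  let Bhat := fun t => U t *m B *m L t in
  let Chat := fun t => C *m invmx (U t) in
  let fhat := fun t z u => U t *m f t (invmx (U t) *m z) u in
  (forall t (i : 'I_p) (j : 'I_n), Chat t i j = (i == j :> nat)%:R) /\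
  exists (Rb : 'I_r -> R -> 'M[R]_(p, p)) (S : R -> 'M[R]_(p, n - p * r))
         (Pb : 'I_r -> R -> 'M[R]_(n - p * r, p)) (Q : R -> 'M[R]_(n - p * r))
         (N : R -> 'M[R]_(n - p * r, m))
         (fr : R -> 'cV[R]_n -> 'cV[R]_m -> 'cV[R]_p)
         (feta : R -> 'cV[R]_n -> 'cV[R]_m -> 'cV[R]_(n - p * r)),
    [/\ (* block forms *)
        [/\ forall t (i j : 'I_n),
          Ahat t i j = Aform (fun k => Rb k t) (S t) (fun k => Pb k t) (Q t) i j,
        forall t (i : 'I_n) (j : 'I_m),
          Bhat t i j =
            (if (i < p * r.-1)%N then 0
             else if (i < p * r)%N then mxn (Gamma *m L t) (i - p * r.-1)%N j
             else mxn (N t) (i - p * r)%N j)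
      & forall t z u (i : 'I_n),
          fhat t z u i 0 =
            (if (i < p * r.-1)%N then 0
             else if (i < p * r)%N then mxn (fr t z u) (i - p * r.-1)%N 0
             else mxn (feta t z u) (i - p * r)%N 0)],
        (* regularity and boundedness of the blocks *)
        [/\ (forall k, smooth_mx (Rb k) /\ bounded_mx (Rb k)),
            (forall k, smooth_mx (Pb k) /\ bounded_mx (Pb k)),
            smooth_mx S /\ bounded_mx S, smooth_mx Q /\ bounded_mx Q
          & smooth_mx N /\ bounded_mx N],
        [/\ continuous (fun w : R * 'cV[R]_n * 'cV[R]_m => fr w.1.1 w.1.2 w.2),
            continuous (fun w : R * 'cV[R]_n * 'cV[R]_m => feta w.1.1 w.1.2 w.2),
            (exists M : R, forall t z u i j, `|fr t z u i j| <= M)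
          & (exists M : R, forall t z u i j, `|feta t z u i j| <= M)],
        (* (i) *)
        ((exists K : R -> 'M[R]_(m, p), smooth_mx K /\
            forall t, Gamma *m L t *m K t = 1%:M /\ N t *m K t = 0) <->
         (forall t, ((calB r A B L t *m mpinv (calC r A C *m calB r A B L t)
                       *m E_last R p r)^T <= (B *m L t)^T)%MS)) /\
        ((forall t, ((calB r A B L t *m mpinv (calC r A C *m calB r A B L t)
                       *m E_last R p r)^T <= (B *m L t)^T)%MS) ->
         let K := fun t => mpinv (B *m L t) *m calB r A B L t
                    *m mpinv (calC r A C *m calB r A B L t) *m E_last R p r in
         smooth_mx K /\ forall t, Gamma *m L t *m K t = 1%:M /\ N t *m K t = 0)
      & (* (ii) *)
        (q = p -> (forall (k : 'I_r), (0 < k)%N -> forall t, Pb k t = 0) /\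
                  (forall t, N t = 0))].
Proof.
move=> _ cf [Mf bf] sL bL rkW _ r0 CAB CAf rkG _ lyU U Gamma Ahat Bhat Chat fhat.
have [W WE] : exists W, W = fun t => B *m L t by eexists.
have sW : smooth_mx W by rewrite WE; exact: smooth_mxM (smooth_mx_cst _) sL.
have {}rkW t : \rank (W t) = q by rewrite WE.
have CAW k : (k < r.-1)%N -> forall t, C *m A ^+ k *m W t = 0.
  by move=> kr t; rewrite WE mulmxA CAB.
have GE t : Gamma *m L t = C *m A ^+ r.-1 *m W t by rewrite /Gamma WE !mulmxA.
have {}rkG t : \rank (C *m A ^+ r.-1 *m W t) = p by rewrite -GE.
pose Cc := calC r A C.
have BE t : calB r A B L t = dArow A r W t.
  by rewrite calB_blockrow; apply: eq_bigr => k _; rewrite BLk_dA -WE.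
have [Z ZW] : exists Z, Z = rinvC A r C W by eexists.
have ZE t : calB r A B L t *m mpinv (Cc *m calB r A B L t) = Z t by rewrite BE ZW.
have CZ t : Cc *m Z t = 1%:M by rewrite ZW; exact: calC_rinvC.
have [N NE] : exists N, N = fun t => mpinv V *m (1%:M - Z t *m Cc) by eexists.
pose top : 'M[R]_(r * p, n) := sel (r * p) n 0.
pose bot : 'M[R]_(n - p * r, n) := sel (n - p * r) n (p * r).
have UE t : U t = top^T *m Cc + bot^T *m N t.
  have -> : bot = sel (n - p * r) n (r * p) by congr (sel _ _ _); exact: mulnC.
  by rewrite /U Umx_sel /calN ZE NE.
(* The product of [calC] with [dArow] has rank r * p; hence the truncated subtraction [n - p * r] is
   exact. *)
have rpn : (r * p <= n)%N.
  have /eqP <- : row_free (Cc *m dArow A r W 0) by exact: row_free_calC_dArow.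
  exact: leq_trans (mxrankM_maxl _ _) (rank_leq_col _).
have prn : (p * r <= n)%N by rewrite mulnC.
have toptop : top *m top^T = 1%:M by rewrite sel_selT_id.
have topbot : top *m bot^T = 0 by rewrite sel_selT_eq0 ?subnKC //; lia.
have botbot : bot *m bot^T = 1%:M by rewrite sel_selT_id ?subnKC.
have bottop : bot *m top^T = 0 by rewrite sel_selT_eq0 //; lia.
have topU t : top *m U t = Cc.
  by rewrite UE mulmxDr !mulmxA toptop topbot mul1mx mul0mx addr0.
have botU t : bot *m U t = N t.
  by rewrite UE mulmxDr !mulmxA bottop botbot mul1mx mul0mx add0r.
have NZ t : N t *m Z t = 0.
  by rewrite NE -mulmxA mulmxBl mul1mx -mulmxA CZ mulmx1 subrr mulmx0.
have UZ t : U t *m Z t = top^T.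
  by rewrite UE mulmxDl -!mulmxA CZ NZ mulmx1 mulmx0 addr0.
have [uU _ bU bUV bdU] := lyU.
have sZ : smooth_mx Z by rewrite ZW; exact: smooth_rinvC.
have sN : smooth_mx N.
  rewrite NE.
  apply: (smooth_mxM (smooth_mx_cst _)); apply: (smooth_mxD (smooth_mx_cst _)).
  by apply: smooth_mxN; exact: smooth_mxM sZ (smooth_mx_cst _).
have sU : smooth_mx U.
  rewrite (_ : U = fun t => top^T *m Cc + bot^T *m N t); last exact/funext.
  exact: smooth_mxD (smooth_mx_cst _) (smooth_mxM (smooth_mx_cst _) sN).
have sUV : smooth_mx (fun t => invmx (U t)) by exact: smooth_invmx.
have sAhat : smooth_mx Ahat.
  apply: (smooth_mxM _ sUV).
  exact: smooth_mxD (smooth_mxM sU (smooth_mx_cst _)) (smooth_mxd sU).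
have bAhat : bounded_mx Ahat.
  apply: (bounded_mxM _ bUV).
  exact: bounded_mxD (bounded_mxM bU (bounded_mx_cst _)) bdU.
have topB k : (k < r)%N -> bsel r k *m top = sel p n (k * p).
  by move=> kr; rewrite sel_sel // block_lt.
have CcE k : (k < r)%N -> bsel r k *m Cc = C *m A ^+ k.
  by move=> kr; rewrite /Cc calC_blockcol bsel_blockcol.
have rowU k t : (k < r)%N -> sel p n (k * p) *m U t = C *m A ^+ k.
  by move=> kr; rewrite -topB // -mulmxA topU CcE.
have sub_smooth a b o o' :
    smooth_mx (fun t => sel a n o *m Ahat t *m (sel b n o')^T)
    /\ bounded_mx (fun t => sel a n o *m Ahat t *m (sel b n o')^T).
  split.
    exact: smooth_mxM (smooth_mxM (smooth_mx_cst _) sAhat) (smooth_mx_cst _).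
  exact: bounded_mxM (bounded_mxM (bounded_mx_cst _) bAhat) (bounded_mx_cst _).
have rowblock (i : 'I_n) : (i < p * r.-1)%N ->
    exists (k : nat) (i' : 'I_p), (k < r.-1)%N /\ i = (k * p + i')%N :> nat.
  move=> ir; have p0 : (0 < p)%N by case: (p) ir.
  exists (i %/ p)%N, (Ordinal (ltn_pmod i p0)); split; last exact: divn_eq.
  by rewrite ltn_divLR // mulnC.
have row0 c (t : R) (X : 'M[R]_(n, c)) :
    (forall k, (k < r.-1)%N -> C *m A ^+ k *m X = 0) ->
    forall (i : 'I_n) j, (i < p * r.-1)%N -> (U t *m X) i j = 0.
  move=> CX i j /rowblock[k [i' [kr ik]]].
  have := CX k kr; rewrite -(rowU k t) -?mulmxA; last by lia.
  move=> /matrixP/(_ i' j); rewrite sel_mulE -ik mxnE => ->.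
  by rewrite mxE.
have lastrow c (t : R) (X : 'M[R]_(n, c)) :
    sel p n (p * r.-1) *m (U t *m X) = C *m A ^+ r.-1 *m X.
  by rewrite mulmxA mulnC rowU // prednK.
have shift t (i j : 'I_n) : (i < p * r.-1)%N -> Ahat t i j = (j == i + p :> nat)%N%:R.
  move=> /rowblock[k [i' [kr ik]]].
  have kr1 : (k < r)%N by lia.
  have kr2 : (k.+1 < r)%N by lia.
  (* Block row k of [U] is the constant C A^k: its derivative vanishes, and C A^k A is block row k +
     1 of [U], which the inverse of [U] turns into a block row of the identity. *)
  have : sel p n (k * p) *m Ahat t = sel p n (k.+1 * p).
    rewrite /Ahat mulmxA mulmxDr mulmxA rowU // -mxD_mulmxl //.
    rewrite (_ : (fun s => _) = fun=> C *m A ^+ k); last by apply/funext => s; exact: rowU.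
    by rewrite mxD_cst addr0 -[C *m A ^+ k *m A]mulmxA mulmxE -exprSr -(rowU _ t kr2) mulmxK.
  move=> /matrixP/(_ i' j); rewrite sel_mulE -ik mxnE => ->.
  by rewrite mxE ik mulSn -[in LHS]addnA [in LHS]addnC.
have bBhat : bounded_mx Bhat.
  apply: bounded_mxM (bounded_mxM bU (bounded_mx_cst _)) _.
  exact: (bL 0%N).
have sBhat : smooth_mx Bhat by exact: smooth_mxM (smooth_mxM sU (smooth_mx_cst _)) sL.
have BhatE t : Bhat t = U t *m W t by rewrite /Bhat WE mulmxA.
have cfhat : continuous (fun w : R * 'cV[R]_n * 'cV[R]_m => fhat w.1.1 w.1.2 w.2).
  have c1 : continuous (fun w : R * 'cV[R]_n * 'cV[R]_m => w.1.1).
    by move=> w; apply: continuous_comp; exact: cvg_fst.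
  have c2 : continuous (fun w : R * 'cV[R]_n * 'cV[R]_m => w.1.2).
    by move=> w; apply: continuous_comp; [exact: cvg_fst|exact: cvg_snd].
  have cM (M : R -> 'M[R]_n) :
      smooth_mx M -> continuous (fun w : R * 'cV[R]_n * 'cV[R]_m => M w.1.1).
    by move=> sM w; apply: continuous_comp (c1 w) _; exact: smooth_mx_continuous.
  apply: continuous_mulmx; first exact: cM.
  move=> w; apply: (@continuous_comp _ _ _
    (fun w : R * 'cV[R]_n * 'cV[R]_m => (w.1.1, invmx (U w.1.1) *m w.1.2, w.2))
    (fun z => f z.1.1 z.1.2 z.2)); last exact: cf.
  have c3 := continuous_mulmx (cM _ sUV) c2.
  exact: (cvg_pair (cvg_pair (c1 w) (c3 w)) cvg_snd).
have [Mfhat bfhat] : exists M : R, forall t z u i j, `|fhat t z u i j| <= M.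
  have [MU HU] := bU.
  by exists (\sum_(k < n) MU * Mf) => t z u; apply: normr_mulmx_le => //; exact: bf.
have sub_f a o :
    continuous (fun w : R * 'cV[R]_n * 'cV[R]_m => sel a n o *m fhat w.1.1 w.1.2 w.2)
    /\ exists M : R, forall t z u i j, `|(sel a n o *m fhat t z u) i j| <= M.
  split; first by apply: continuous_mulmx => //; exact: cst_continuous.
  have [MS HS] := bounded_mx_cst (sel a n o : 'M[R]_(a, n)).
  by exists (\sum_(k < n) MS * Mfhat) => t z u; apply: normr_mulmx_le => //; exact: HS 0.
pose El : 'M[R]_(r * p, p) := (bsel r r.-1)^T.
have r1 : (r.-1 < r)%N by rewrite prednK.
have CcW t : Cc *m W t = El *m (Gamma *m L t).
  rewrite /Cc calC_blockcol /blockcol mulmx_suml (bigD1 (Ordinal r1)) //= -mulmxA -GE.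
  rewrite big1 ?addr0 // => k; rewrite -val_eqE /= => kr.
  by rewrite -mulmxA CAW ?mulmx0 //; have := ltn_ord k; lia.
have botB t : bot *m Bhat t = N t *m W t by rewrite BhatE mulmxA botU.
have ElK t (X : 'M[R]_(m, p)) :
    Gamma *m L t *m X = 1%:M /\ bot *m Bhat t *m X = 0 <-> W t *m X = Z t *m El.
  split=> [[GX NX]|WX].
    (* Both sides are compared after applying the invertible [U t]: U Z = [I; 0], while U W X has
       the parts [0; Gamma L X] and N W X. *)
    suff : U t *m (W t *m X) = U t *m (Z t *m El).
      by move=> /(congr1 (mulmx (invmx (U t)))); rewrite !mulKmx.
    rewrite [RHS]mulmxA UZ UE mulmxDl -!mulmxA (mulmxA Cc) CcW -(mulmxA El) GX mulmx1.
    by rewrite (mulmxA (N t)) -botB NX mulmx0 addr0.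
  split; last by rewrite botB -mulmxA WX mulmxA NZ mul0mx.
  by rewrite GE -mulmxA WX -CcE // -!mulmxA (mulmxA Cc) CZ mul1mx bsel_bselT // eqxx.
have imE t : ((calB r A B L t *m mpinv (calC r A C *m calB r A B L t) *m E_last R p r)^T
    <= (B *m L t)^T)%MS <-> ((Z t *m El)^T <= (W t)^T)%MS.
  by rewrite -/Cc ZE E_last_bsel WE.
(* By the inclusion, W W^+ acts as the identity on Z [0; I], so [ElK] applies; [K] is smooth because
   [W] has constant rank [q]. *)
have Kim : (forall t, ((Z t *m El)^T <= (W t)^T)%MS) ->
    let K := fun t => mpinv (W t) *m Z t *m El in
    smooth_mx K /\ forall t, Gamma *m L t *m K t = 1%:M /\ bot *m Bhat t *m K t = 0.
  move=> im K; split.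
    by apply: smooth_mxM (smooth_mx_cst _); apply: (smooth_mxM _ sZ); exact: smooth_mpinv sW rkW.
  by move=> t; apply/ElK; rewrite /K -!mulmxA (mulmxA (W t)) mulmx_mpinv_id.
split.
  move=> t i j; have : Chat t = sel p n 0.
    have := rowU 0%N t r0; rewrite mul0n expr0 mulmx1 /Chat => <-.
    by rewrite mulmxK.
  by move=> ->; rewrite mxE add0n eq_sym.
(* All witnesses are sub-blocks of [Ahat], [Bhat] and [fhat], whose regularity and bounds they
   inherit. *)
exists (fun k t => sel p n (p * r.-1) *m Ahat t *m (sel p n (p * k))^T).
exists (fun t => sel p n (p * r.-1) *m Ahat t *m bot^T).
exists (fun k t => bot *m Ahat t *m (sel p n (p * k))^T).
exists (fun t => bot *m Ahat t *m bot^T).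
exists (fun t => bot *m Bhat t).
exists (fun t z u => sel p n (p * r.-1) *m fhat t z u).
exists (fun t z u => bot *m fhat t z u).
split.
- split.
  + by move=> t i j; apply: Aform_sel => //; exact: shift.
  + move=> t i j; rewrite GE -(lastrow _ t) -BhatE; apply: stacked_sel => //.
    by rewrite BhatE; apply: row0 => k kr; exact: CAW.
  + move=> t z u i; apply: stacked_sel => //.
    by apply: row0 => k kr; exact: CAf.
- split; [by move=> k; exact: sub_smooth|by move=> k; exact: sub_smooth
         |exact: sub_smooth|exact: sub_smooth|].
  by split; [exact: smooth_mxM (smooth_mx_cst _) sBhat|exact: bounded_mxM (bounded_mx_cst _) bBhat].
- have [c1 b1] := sub_f p (p * r.-1)%N.
  have [c2 b2] := sub_f (n - p * r)%N (p * r)%N.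
  by split.
- split; last first.
    move=> im K; have := Kim (fun t => (imE t).1 (im t)).
    rewrite (_ : K = fun t => mpinv (W t) *m Z t *m El) //.
    by apply/funext => t; rewrite /K -(mulmxA (mpinv _)) ZE E_last_bsel WE.
  split=> [[K [sK HK]] t|im].
    by apply/imE; rewrite -((ElK t (K t)).1 (HK t)) trmx_mul submxMl.
  by eexists; exact: Kim (fun t => (imE t).1 (im t)).
- move=> qp; rewrite qp in rkW.
  have [NW NAZ] := calN_square_case A C sW CAW rkG r0 rkW (mpinv V).
  split=> [k k0 t|t]; last by rewrite botB NE ZW; exact: NW.
  (* Since U Z = [I; 0], the leading block columns of the inverse of [U t] are those of [Z t], and
     [bot] extracts [N] from [U] and its derivative. *)
  have -> : bot *m Ahat t *m (sel p n (p * k))^T =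
      (N t *m A + mxD N t) *m Z t *m (bsel r k)^T; last first.
    by rewrite NE ZW; apply: NAZ; rewrite k0 ltn_ord.
  rewrite [(p * k)%N]mulnC -topB // trmx_mul mulmxA; congr (_ *m _).
  rewrite -(UZ t) /Ahat -!mulmxA mulKmx //.
  rewrite !mulmxA; congr (_ *m _); rewrite mulmxDr mulmxA botU -mxD_mulmxl //.
  by congr (_ + mxD _ t); apply/funext => s; exact: botU.
Qed.
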